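(* Every Peano continuum with more than one point is the image of $A_{\mathfrak{c}}$ via a light open mapping.
   Context: A Peano continuum is a metrizable space that is a continuous image of $[0,1]$. A (continuous) mapping is light if every point pre-image is totally disconnected, and open if it maps open sets to open sets. An $\mathbb{R}$-tree is a geodesic metric space with more than one point that is $0$-hyperbolic in Gromov's sense (equivalently, any two points are joined by a unique arc, which is a geodesic). The valency of an $\mathbb{R}$-tree $T$ at $t$ is the cardinality of the set of connected components of $T\setminus\{t\}$. With $\mathfrak{c}=2^{\aleph_0}$, $A_{\mathfrak{c}}$ is the unique (up to isometry) complete $\mathbb{R}$-tree with valency $\mathfrak{c}$ at each point. *)

(* Defs.v *)
From HB Require Import structures.
From mathcomp Require Import all_boot all_order all_algebra.
From mathcomp Require Import all_classical all_reals all_analysis.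

Set Implicit Arguments.
Unset Strict Implicit.
Unset Printing Implicit Defensive.

Import Order.TTheory GRing.Theory Num.Theory.
Import numFieldNormedType.Exports.

Local Open Scope classical_set_scope.
Local Open Scope ring_scope.
Local Open Scope card_scope.

Definition metrizable (R : realType) (X : topologicalType) : Prop :=
  exists d : X -> X -> R,
    [/\ forall x y, d x y = 0 <-> x = y,
        forall x y, d x y = d y x,
        forall x y z, d x z <= d x y + d y z
      & forall (x : X) (A : set X),
          nbhs x A <-> exists2 e : R, 0 < e & [set y | d x y < e] `<=` A].

Definition Peano_continuum (R : realType) (X : topologicalType) : Prop :=
  metrizable R X /\
  exists2 f : R -> X, {within `[0, 1], continuous f} & f @` `[0, 1] = [set: X].

Definition more_than_one_point (X : Type) : Prop := exists x y : X, x <> y.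

Definition light (S X : topologicalType) (f : S -> X) : Prop :=
  forall x : X, totally_disconnected (f @^-1` [set x]).

Definition open_mapping (S X : topologicalType) (f : S -> X) : Prop :=
  forall U : set S, open U -> open (f @` U).

Section RTrees.
Context {R : realType}.

(* The values of g outside `[0, mdist x y] are irrelevant. *)
Definition geodesic_space (T : metricType R) : Prop :=
  forall x y : T, exists g : R -> T,
    [/\ g 0 = x,
        g (mdist x y) = y
      & {in `[0, mdist x y] &, forall s t, mdist (g s) (g t) = `|s - t|}].

Definition Gromov_product (T : metricType R) (w x y : T) : R :=
  (mdist x w + mdist y w - mdist x y) / 2.

Definition zero_hyperbolic (T : metricType R) : Prop :=
  forall w x y z : T,
    Num.min (Gromov_product w x y) (Gromov_product w y z)
      <= Gromov_product w x z.

Definition R_tree (T : metricType R) : Prop :=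
  [/\ geodesic_space T, more_than_one_point T & zero_hyperbolic T].

(* The library's completeType and cvg require a pointed type. *)
Definition complete_space (T : metricType R) : Prop :=
  forall F : set_system T, ProperFilter F -> cauchy F -> exists x : T, F --> x.

Definition components_off (T : metricType R) (t : T) : set (set T) :=
  connected_component (~` [set t]) @` (~` [set t]).

(* The valency at t is compared with the continuum by equipotence with the
   power set of nat, since the library has no type of cardinals. *)
Definition valency_continuum (T : metricType R) (t : T) : Prop :=
  components_off t #= [set: set nat].

(* A_c is determined only up to isometry, so it is given by the properties
   that characterize it: a statement about A_c is a statement about every T
   satisfying is_A_c. *)
Definition is_A_c (T : metricType R) : Prop :=
  [/\ R_tree T, complete_space T & forall t : T, valency_continuum t].

End RTrees.

(* Main.v *)
(* The map is built on larger and larger closed subtrees of A_c, by Zorn's lemma.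
   No convex metric on X is needed, because a move of X is only required to be
   slow at its start: along an arc attached at t the image stays within
   distance u of f t at distance u from t, with no Lipschitz condition between
   later points of the arc. Hence f w is within mdist s w of f s whenever s is
   the point at which w leaves a smaller subtree, however many arcs were attached
   in between, and this gives continuity of the limit maps. The moves are pieces
   of the given path [0, 1] -> X, which is already enough to reach all points
   near f t, and they are reparametrized so as to be slow at the start and
   constant on no interval; this makes the map light. Since each t has continuum
   many branches, of which the subtree meets at most two when t is treated, for
   every y in X a branch at t can be assigned a move from f t to y, of length
   tending to 0 as y tends to f t; this makes the map open and onto. *)
Require Import Defs.
From HB Require Import structures.
From mathcomp Require Import all_boot all_order all_algebra.
From mathcomp Require Import all_classical all_reals all_analysis.
From mathcomp Require Import lra.

Set Implicit Arguments.
Unset Strict Implicit.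
Unset Printing Implicit Defensive.

Import Order.TTheory GRing.Theory Num.Theory.
Import numFieldNormedType.Exports.

Local Open Scope classical_set_scope.
Local Open Scope ring_scope.

(** * Preliminaries *)

(** Zorn's lemma for a preorder on the elements satisfying [P]. Partial maps that agree on their
    domain may differ elsewhere, so [extends] is not antisymmetric, and its transitivity needs the
    middle term to be a partial map. *)
Lemma premaximal_on (T : Type) (P : set T) (E : T -> T -> Prop) (t0 : T) :
  P t0 -> (forall t, E t t) ->
  (forall r s t, P s -> E r s -> E s t -> E r t) ->
  (forall A, A `<=` P -> A !=set0 ->
     total_on A E -> exists2 u, P u & forall s, A s -> E s u) ->
  exists2 t, P t & forall s, P s -> E t s -> E s t.
Proof.
move=> Pt0 Exx Etrans chain.
have [||A totA|[t Pt] tmax] := @ZL_preorder {t | P t} (exist _ t0 Pt0)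
    (fun s t => `[< E (sval s) (sval t) >]).
- by move=> t; apply/asboolP.
- by move=> r s t /asboolP rs /asboolP st; apply/asboolP/(Etrans _ _ _ _ rs st)/svalP.
- have [[a Aa]|A0] := pselect (A !=set0); last first.
    by exists (exist _ t0 Pt0) => s As; case: A0; exists s.
  have [||s t [s' As' <-] [t' At' <-]|u Pu Au] := chain (sval @` A).
  + by move=> _ [s _ <-]; exact: svalP.
  + by exists (sval a), a.
  + by case: (totA _ _ As' At') => /asboolP; [left|right].
  + by exists (exist _ u Pu) => s As; apply/asboolP/Au; exists s.
- exists t => // s Ps Ets.
  by apply/asboolP/(tmax (exist _ s Ps)); apply/asboolP.
Qed.

Section RealFacts.
Context {R : realType}.

Lemma harmonic_lt (e : R) : 0 < e -> exists n : nat, harmonic n < e.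
Proof.
move=> e0; have [n _ /(_ n (leqnn n))] := near_infty_natSinv_lt (PosNum e0).
by exists n.
Qed.

Lemma harmonic_anti (n m : nat) : (n <= m)%N -> harmonic m <= harmonic n :> R.
Proof. by move=> nm; rewrite /harmonic lef_pV2 ?posrE ?ltr0n// ler_nat ltnS. Qed.

Lemma le_harmonic (a b c : R) : 0 <= c ->
  (forall n : nat, a <= b + c * harmonic n) -> a <= b.
Proof.
move=> c0 ab; apply/ler_addgt0Pl => e e0.
have [n ne] : exists n : nat, harmonic n < e / (c + 1).
  by apply: harmonic_lt; rewrite divr_gt0// ltr_wpDl.
have cp : 0 < c + 1 by lra.
rewrite ltr_pdivlMr// in ne.
have := ab n; have := @harmonic_gt0 R n; nra.
Qed.

Lemma approx_max (T : Type) (A : set T) (h : T -> R) (B e : R) :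
  A !=set0 -> (forall x, A x -> h x <= B) -> 0 < e ->
  exists2 x, A x & forall y, A y -> h y <= h x + e.
Proof.
move=> [a Aa] hB e0.
have hs : has_sup (h @` A).
  by split; [exists (h a), a|exists B => _ [x Ax <-]; exact: hB].
have [_ [x Ax <-] xe] := sup_adherent e0 hs.
exists x => // y Ay; have : h y <= sup (h @` A).
  by apply: ub_le_sup; [case: hs|exists y].
by lra.
Qed.

End RealFacts.

Section RealAnalysis.
Context {R : realType}.

Lemma continuous_eps_delta (phi : R -> R) :
  (forall u e, 0 < e -> exists2 h, 0 < h &
     forall v, `|u - v| < h -> `|phi u - phi v| < e) -> continuous phi.
Proof.
move=> cphi u; apply/cvgrPdist_lt => e e0; have [h h0 uh] := cphi u e e0.
by apply/nbhs_ballP; exists h => // v; exact: uh.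
Qed.

(** By compactness [phi] attains a positive minimum on the part of [0, 1] outside [U], unless that
    part is empty; this minimum is [h]. *)
Lemma open_near_zeros (phi : R -> R) (U : set R) : continuous phi -> open U ->
  (forall u, 0 <= u <= 1 -> 0 <= phi u) ->
  (forall u, 0 <= u <= 1 -> phi u = 0 -> U u) ->
  exists2 h, 0 < h & forall u, 0 <= u <= 1 -> phi u < h -> U u.
Proof.
move=> cphi oU phi0 phiU; pose K := `[0, 1]%classic `&` ~` U.
have [K0|K0] := pselect (K !=set0); last first.
  exists 1 => // u u01 _; apply: contrapT => nU; apply: K0.
  by exists u; split; rewrite //= in_itv.
have cK : compact K.
  by apply: compact_closedI; [exact: segment_compact|exact: open_closedC].
have [c] := compact_EVT_min K0 cK (continuous_subspaceT cphi).
rewrite inE => -[/=]; rewrite in_itv /= => c01 nUc cmin.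
exists (phi c) => [|u u01 ltu].
  by rewrite lt_neqAle phi0// andbT eq_sym; apply/eqP => /phiU -/(_ c01).
apply: contrapT => nU; move: ltu.
by rewrite ltNge cmin// inE; split; rewrite //= in_itv.
Qed.

End RealAnalysis.

(** * Slow paths *)

Section Paths.
Context {R : realType} {X : Type} (d : X -> X -> R).
Hypothesis d_eq0 : forall x y, d x y = 0 <-> x = y.
Hypothesis d_sym : forall x y, d x y = d y x.
Hypothesis d_tri : forall x y z, d x z <= d x y + d y z.

Lemma dist_xx x : d x x = 0. Proof. exact/d_eq0. Qed.

Lemma dist_ge0 x y : 0 <= d x y.
Proof. have := d_tri x y x; rewrite dist_xx (d_sym y x); lra. Qed.

Lemma dist_gt0 x y : x <> y -> 0 < d x y.
Proof.
by move=> xy; rewrite lt_neqAle dist_ge0 andbT eq_sym; apply/eqP => /d_eq0.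
Qed.

Definition continuous_path (b : R -> X) := forall u e, 0 < e ->
  exists2 h, 0 < h & forall v, `|u - v| < h -> d (b u) (b v) < e.

Definition slow_path x y h (c : R -> X) :=
  [/\ [/\ 0 < h, c 0 = x & c h = y],
      forall u, 0 <= u <= h -> d x (c u) <= u,
      forall u e, 0 <= u <= h -> 0 < e -> exists2 r, 0 < r &
        forall v, 0 <= v <= h -> `|u - v| < r -> d (c u) (c v) < e
    & forall u v, 0 <= u -> u < v -> v <= h ->
        exists r r', [/\ u <= r <= v, u <= r' <= v & c r <> c r']].

(** * A clock that advances exactly when a path moves *)

Section Clock.
Variables (B : R) (b : R -> X).
Hypotheses (dB : forall x y, d x y <= B) (bcont : continuous_path b).

(* [0] is included so that the supremum is that of a nonempty set. *)
Let M q u := sup [set r | r = 0 \/ exists2 v, q <= v <= u & r = d (b q) (b v)].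

Let Mhas q u :
  has_sup [set r | r = 0 \/ exists2 v, q <= v <= u & r = d (b q) (b v)].
Proof.
split; first by exists 0; left.
exists B => r [->|[v _ ->]//].
exact: (le_trans (dist_ge0 (b 0) (b 0))).
Qed.

Let M_ge0 q u : 0 <= M q u.
Proof. by apply: ub_le_sup; [case: (Mhas q u)|left]. Qed.

Let M_ge q u v : q <= v <= u -> d (b q) (b v) <= M q u.
Proof. by move=> qvu; apply: ub_le_sup; [case: (Mhas q u)|right; exists v]. Qed.

Let M_le q u c : 0 <= c -> (forall v, q <= v <= u -> d (b q) (b v) <= c) ->
  M q u <= c.
Proof.
move=> c0 qc; apply: ge_sup; first by case: (Mhas q u).
by move=> _ [->//|[v qvu ->]]; exact: qc.
Qed.

Let M_mono q u v : u <= v -> M q u <= M q v.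
Proof.
move=> uv; apply: M_le => // w /andP[qw wu]; apply: M_ge.
by rewrite qw (le_trans wu uv).
Qed.

(** The factor 2 comes from times [q] after [u]: there both [b q] and [b w] may be at distance [c]
    from [b u]. *)
Let M_after q u v c : u <= v -> (forall w, u <= w <= v -> d (b u) (b w) <= c) ->
  M q v <= M q u + 2 * c.
Proof.
move=> uv uc; have c0 : 0 <= c.
  by rewrite -(dist_xx (b u)) uc// lexx uv.
have := M_ge0 q u => ?; apply: M_le => [|w /andP[qw wv]]; first lra.
have [wu|/ltW uw] := leP w u.
  by have := @M_ge q u w; rewrite qw wu => /(_ isT); lra.
have bw : d (b u) (b w) <= c by apply: uc; rewrite uw.
have := d_tri (b q) (b u) (b w).
have [qu|uq] := leP q u.
  by have := @M_ge q u u; rewrite qu lexx => /(_ isT); lra.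
have : d (b u) (b q) <= c by apply: uc; rewrite (ltW uq) (le_trans qw wv).
rewrite (d_sym (b q) (b u)); lra.
Qed.

Let M_before q u : u <= q -> M q u = 0.
Proof.
move=> uq; apply/eqP; rewrite eq_le M_ge0 andbT; apply: M_le => // v /andP[qv vu].
have -> : v = q by apply/eqP; rewrite eq_le qv (le_trans vu uq).
by rewrite dist_xx.
Qed.

(** Time 0 comes first, with weight 1, so that [clock_start] loses no constant. The rationals follow
    through their codes; the default 0 for a number that codes nothing is harmless. *)
Let cut (i : nat) : R := if i is n.+1 then ratr (odflt 0 (unpickle n)) else 0.
Let S n u := \sum_(i < n) 2^-1 ^+ i * M (cut i) u.

Let w_gt0 i : 0 < 2^-1 ^+ i :> R. Proof. by rewrite exprn_gt0// invr_gt0. Qed.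

Let w_sum n : \sum_(i < n) 2^-1 ^+ i <= 2 :> R.
Proof.
suff -> : \sum_(i < n) 2^-1 ^+ i = 2 - 2 * 2^-1 ^+ n :> R.
  by have := w_gt0 n; lra.
elim: n => [|n IH]; first by rewrite big_ord0 expr0; lra.
by rewrite big_ord_recr /= IH exprS; lra.
Qed.

Let S_after n u v c : 0 <= c -> (forall q, M q v <= M q u + c) ->
  S n v <= S n u + 2 * c.
Proof.
move=> c0 uv; apply: (@le_trans _ _ (S n u + \sum_(i < n) 2^-1 ^+ i * c)).
  rewrite /S -big_split /=; apply: ler_sum => i _.
  by rewrite -mulrDr ler_pM2l.
by rewrite lerD2l -mulr_suml ler_wpM2r.
Qed.

Let S_nat u n m : S n u <= S (n + m) u.
Proof.
rewrite /S big_split_ord /= lerDl; apply: sumr_ge0 => i _.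
by rewrite mulr_ge0// ltW.
Qed.

(* A weighted sum of the oscillations of b after each rational time: it advances
   exactly when b moves, and at least as fast as b leaves its starting point. *)
Definition clock u := sup (range (S^~ u)).

Let clock_has u : has_sup (range (S^~ u)).
Proof.
split; first by exists (S 0%N u), 0%N.
have B0 : 0 <= B := le_trans (dist_ge0 (b 0) (b 0)) (dB _ _).
exists (2 * B) => _ [n _ <-]; apply: (@le_trans _ _ (\sum_(i < n) 2^-1 ^+ i * B)).
  by apply: ler_sum => i _; rewrite ler_pM2l// M_le.
by rewrite -mulr_suml ler_wpM2r.
Qed.

Let clock_ge n u : S n u <= clock u.
Proof. by apply: ub_le_sup; [case: (clock_has u)|exists n]. Qed.

(** The weights sum to at most 2 and each oscillation grows by at most [2 * c] ([M_after]), hence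
    the 4. *)
Lemma clock_after u v c : u <= v ->
  (forall w, u <= w <= v -> d (b u) (b w) <= c) -> clock v <= clock u + 4 * c.
Proof.
move=> uv uc; have c0 : 0 <= c by rewrite -(dist_xx (b u)) uc// lexx uv.
apply: ge_sup => [|_ [n _ <-]]; first by case: (clock_has v).
have := @S_after n u v (2 * c); have := clock_ge n u => ? /(_ _ _).
move=> H; have /H : 0 <= 2 * c by lra.
by move=> /(_ (fun q => M_after q uv uc)); lra.
Qed.

(** The term of index [i] vanishes at [u] and is at least the weighted distance at [v]; the other
    terms do not decrease. *)
Let clock_jump i u v : u <= cut i <= v ->
  clock u + 2^-1 ^+ i * d (b (cut i)) (b v) <= clock v.
Proof.
move=> /andP[ui iv]; have uv := le_trans ui iv.
rewrite -lerBrDr; apply: ge_sup => [|_ [n _ <-]]; first by case: (clock_has u).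
(* The partial sum is lengthened so that it contains the index [i]. *)
rewrite lerBrDr; apply: le_trans (clock_ge (n + i.+1) v).
apply: le_trans (_ : S (n + i.+1) u + 2^-1 ^+ i * d (b (cut i)) (b v) <= _).
  by rewrite lerD2r.
rewrite addrC -lerBrDr /S -sumrB.
have ilt : (i < n + i.+1)%N by rewrite addnS ltnS leq_addl.
rewrite (bigD1 (Ordinal ilt)) //= (M_before ui) mulr0 subr0.
apply: (@le_trans _ _ (2^-1 ^+ i * M (cut i) v)).
  by rewrite ler_pM2l// M_ge// iv lexx.
rewrite lerDl; apply: sumr_ge0 => j _.
by rewrite -mulrBr mulr_ge0 ?subr_ge0 ?M_mono// ltW.
Qed.

Lemma clock_mono u v : u <= v -> clock u <= clock v.
Proof.
move=> uv; apply: ge_sup => [|_ [n _ <-]]; first by case: (clock_has u).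
apply: le_trans (clock_ge n v); apply: ler_sum => i _.
by rewrite ler_pM2l ?M_mono.
Qed.

Lemma clock_start u : 0 <= u -> clock 0 + d (b 0) (b u) <= clock u.
Proof. by move=> u0; have := @clock_jump 0%N 0 u; rewrite expr0 mul1r lexx u0 => /(_ isT). Qed.

Lemma clock_strict u v : u <= v -> b u <> b v -> clock u < clock v.
Proof.
rewrite le_eqVlt => /orP[/eqP ->//|uv] buv.
have [h h0 uh] := bcont u (dist_gt0 buv).
(* The cut is a rational time just after [u], when [b] is still closer to [b u] than [b v] is, so
   that [b] has yet to move. *)
have [|q] := @rat_in_itvoo _ u (Num.min v (u + h)).
  by rewrite lt_min uv ltrDl.
rewrite in_itv /= lt_min => /andP[uq /andP[qv quh]].
have cutq : cut (pickle q).+1 = ratr q by rewrite /cut pickleK.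
have := @clock_jump (pickle q).+1 u v; rewrite cutq (ltW uq) (ltW qv) => /(_ isT).
apply: lt_le_trans; rewrite ltrDl mulr_gt0// dist_gt0// => bqv.
have /uh : `|u - ratr q| < h by rewrite ltr_distlC; apply/andP; split; lra.
by rewrite bqv ltxx.
Qed.

Lemma clock_continuous : continuous clock.
Proof.
apply: continuous_eps_delta => u e e0.
(* Looking forward from [u] costs [4 * (e / 9)]. Looking back, distances are measured from [b v],
   which doubles the cost. *)
have e9 : 0 < e / 9 by rewrite divr_gt0.
have [h h0 uh] := bcont u e9; exists h => // v uv.
have [lt|le] := ltP u v.
  have := @clock_after u v (e / 9) (ltW lt); have := clock_mono (ltW lt).
  rewrite distrC => ? H; rewrite ger0_norm; last lra.
  have : clock v <= clock u + 4 * (e / 9).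
    apply: H => w /andP[uw wv]; apply/ltW/uh; move: uv.
    rewrite !ltr_distlC => /andP[]; lra.
  lra.
have := @clock_after v u (2 * (e / 9)) le; have := clock_mono le.
move=> ? H; rewrite ger0_norm; last lra.
have : clock u <= clock v + 4 * (2 * (e / 9)).
  apply: H => w /andP[vw wu]; have := uh v uv.
  have : d (b u) (b w) < e / 9.
    by apply/uh; move: uv; rewrite !ltr_distlC => /andP[]; lra.
  have := d_tri (b v) (b u) (b w); rewrite (d_sym (b v) (b u)); lra.
lra.
Qed.

(** The path is run at times [U r] at which the clock shows [clock 0 + r]. Times with the same clock
    value have the same image under [b], so [b \o U] does not depend on the choice of [U], which
    itself need not be continuous. *)
Lemma slow_reparametrization : b 0 <> b 1 ->
  exists h c, slow_path (b 0) (b 1) h c /\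
    forall e, (forall w, 0 <= w <= 1 -> d (b 0) (b w) <= e) -> h <= 4 * e.
Proof.
move=> b01; pose h := clock 1 - clock 0.
have clockK u v : clock u = clock v -> b u = b v.
  move=> e; apply: contrapT => buv; have [uv|/ltW vu] := leP u v.
    by have := clock_strict uv buv; rewrite e ltxx.
  by have := clock_strict vu (nesym buv); rewrite e ltxx.
have h0 : 0 < h by rewrite subr_gt0 clock_strict.
have inv r : exists u, 0 <= r <= h -> 0 <= u <= 1 /\ clock u = clock 0 + r.
  have [r0h|nr] := pselect (0 <= r <= h); last by exists 0.
  have [|u] := @IVT R clock 0 1 (clock 0 + r) ler01
    (continuous_subspaceT clock_continuous).
    rewrite min_l ?max_r; first by move: r0h; rewrite /h; lra.
    - by rewrite clock_mono.
    - by rewrite clock_mono.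
  by rewrite in_itv /=; exists u.
have [U UP] := choice inv.
have UE u : 0 <= u <= 1 -> b (U (clock u - clock 0)) = b u.
  move=> /andP[u0 u1]; apply: clockK.
  have /UP[_ ->] : 0 <= clock u - clock 0 <= h.
    by rewrite subr_ge0 lerD2r !clock_mono.
  by rewrite addrC subrK.
exists h, (b \o U); split; last first.
  by move=> e be; have := clock_after ler01 be; rewrite /h; lra.
split=> [|r r0h|r e r0h e0|r r' r0 rr' r'h] /=.
- split=> //; last by rewrite UE// lexx ler01.
  by rewrite -[X in U X](subrr (clock 0)) UE// lexx ler01.
- have [/andP[U0 _] Ur] := UP r r0h; have := clock_start U0; lra.
- have [U01 Ur] := UP r r0h.
  (* Where the clock shows the same as at [U r], [b] takes the same value; by compactness, where it
     shows nearly the same, [b] is nearly there. *)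
  have [||||k k0 kP] := @open_near_zeros _ (fun u => `|clock u - clock (U r)|)
    [set u | exists2 k, 0 < k & forall v, `|u - v| < k -> d (b (U r)) (b v) < e].
  + apply: continuous_eps_delta => u k k0.
    have /cvgrPdist_lt/(_ k k0)/nbhs_ballP[l /= l0 lP] := @clock_continuous u.
    exists l => // v /lP; apply: le_lt_trans.
    apply: le_trans (ler_dist_dist _ _) _.
    by rewrite opprB addrA subrK.
  + rewrite openE => u /= [k k0 uk]; apply/nbhs_ballP; exists (k / 2) => /=.
      by rewrite divr_gt0.
    move=> v /= uv; exists (k / 2) => [|w vw]; first by rewrite divr_gt0.
    apply: uk; have := ler_distD v u w.
    rewrite /ball /= in uv; lra.
  + by [].
  + move=> u _ /normr0_eq0/subr0_eq/clockK bu; have [k k0 uk] := bcont u e0.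
    by exists k; rewrite // -bu.
  + exists k => // v v0h rv; have [V01 Uv] := UP v v0h.
    have [|l l0] := kP (U v) V01.
      by rewrite Uv Ur opprD addrACA subrr add0r distrC.
    by apply; rewrite subrr normr0.
- have r0h : 0 <= r <= h by lra.
  have r'0h : 0 <= r' <= h by lra.
  have [U01 Ur] := UP r r0h; have [U'01 Ur'] := UP r' r'0h.
  (* If [b \o U] were constant from [r] to [r'], then so would be [b] from [U r] to [U r'], and the
     clock would not advance. *)
  apply: contrapT => const.
  have UU' : U r <= U r'.
    by rewrite leNgt; apply/negP => /ltW/clock_mono; rewrite Ur Ur'; lra.
  have := @clock_after (U r) (U r') 0 UU'; rewrite Ur Ur' => H.
  suff : clock 0 + r' <= clock 0 + r + 4 * 0 by lra.
  apply: H => w /andP[rw wr']; rewrite le_eqVlt; apply/orP; left; apply/eqP/d_eq0.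
  apply: contrapT => brw; apply: const.
  have := clock_mono rw; have := clock_mono wr'; rewrite Ur Ur' => ? ?.
  exists r, (clock w - clock 0); split; [lra|lra|] => /=.
  by rewrite UE//; apply/andP; split; lra.
Qed.

End Clock.

(** * Slow paths cut out of a path onto the whole space *)

Variable g : R -> X.
Hypothesis gcont : continuous_path g.
Hypothesis gsurj : forall x, exists2 a, 0 <= a <= 1 & g a = x.

Lemma dist_path_continuous x : continuous (fun u => d x (g u)).
Proof.
apply: continuous_eps_delta => u e e0; have [h h0 uh] := gcont u e0.
exists h => // v /uh uv; rewrite ltr_distlC.
have := d_tri x (g u) (g v); have := d_tri x (g v) (g u).
by rewrite (d_sym (g v) (g u)) => ? ?; apply/andP; split; lra.
Qed.

Lemma dist_bounded : exists B, forall x y, d x y <= B.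
Proof.
have [c _ cmax] := EVT_max ler01 (continuous_subspaceT (@dist_path_continuous (g 0))).
exists (2 * d (g 0) (g c)) => x y.
have [a a01 <-] := gsurj x; have [b b01 <-] := gsurj y.
have := cmax a; have := cmax b; rewrite !in_itv /= a01 b01 => /(_ isT) ? /(_ isT) ?.
have := d_tri (g a) (g 0) (g b); rewrite (d_sym (g a) (g 0)); lra.
Qed.

Lemma affine_path_continuous (a b : R) :
  continuous_path (fun s => g (a + s * (b - a))).
Proof.
move=> u e e0; have [h h0 uh] := gcont (a + u * (b - a)) e0.
have n0 : 0 < `|b - a| + 1 by rewrite ltr_wpDl.
exists (h / (`|b - a| + 1)); first by rewrite divr_gt0.
move=> v; rewrite ltr_pdivlMr// => uv; apply: uh.
have -> : a + u * (b - a) - (a + v * (b - a)) = (u - v) * (b - a) by lra.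
rewrite normrM; apply: le_lt_trans uv; by rewrite ler_wpM2l// lerDl ler01.
Qed.

Lemma slow_path_along (a b e : R) : g a <> g b ->
  (forall w, `|a - w| <= `|a - b| -> d (g a) (g w) <= e) ->
  exists h c, slow_path (g a) (g b) h c /\ h <= 4 * e.
Proof.
move=> gab abe; have [B dB] := dist_bounded.
have := slow_reparametrization dB (@affine_path_continuous a b).
rewrite mul0r addr0 mul1r addrC subrK => /(_ gab)[h [c [hc small]]].
exists h, c; split=> //; apply: small => w /andP[w0 w1]; apply: abe.
rewrite opprD addrA subrr sub0r normrN normrM distrC.
by rewrite ler_piMl// ger0_norm.
Qed.

(** Lengths are taken within a factor 2 of the infimum, so [h y] is small as soon as some short slow
    path to [y] exists. For [y] near [x] one does: by compactness, any parameter of [y] is close to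
    a parameter of [x], and the piece of [g] between them is small. *)
Lemma slow_path_family x : exists (h : X -> R) (c : X -> R -> X),
  (forall y, y <> x -> slow_path x y (h y) (c y)) /\
  forall e, 0 < e ->
    exists2 r, 0 < r & forall y, y <> x -> d x y < r -> h y < e.
Proof.
have best y : exists hc : R * (R -> X), y <> x ->
    slow_path x y hc.1 hc.2 /\ forall h c, slow_path x y h c -> hc.1 <= 2 * h.
  have [->|yx] := pselect (y = x); first by exists (0, fun=> x).
  have slow_ge h c : slow_path x y h c -> d x y <= h.
    by move=> [[h0 _ <-] H _ _]; apply: H; rewrite lexx (ltW h0).
  pose A := [set h | exists c, slow_path x y h c].
  (* The slack [d x y] is at most the length of any slow path to [y], whence the factor 2. *)
  have [|||h [c hc] hmin] := @approx_max _ _ A (@GRing.opp R) 0 (d x y).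
  - have [a _ ga] := gsurj x; have [b _ gb] := gsurj y.
    have [B dB] := dist_bounded.
    have [||h [c [hc _]]] := @slow_path_along a b B; rewrite ?ga ?gb//.
    + exact: nesym.
    + by move: hc; rewrite ga gb => hc; exists h, c.
  - by move=> h [c /slow_ge]; have := dist_ge0 x y; lra.
  - by apply: dist_gt0; exact: nesym.
  exists (h, c) => _; split=> // h' c' hc'.
  have /hmin : A h' by exists c'.
  by have := slow_ge _ _ hc'; rewrite /=; lra.
have [hc hcP] := choice best.
exists (fun y => (hc y).1), (fun y => (hc y).2).
split=> [y /hcP[]//|e e0]; have e9 : 0 < e / 9 by rewrite divr_gt0.
(* A piece of [g] within [e / 9] of [x] gives a length of at most [4 * (e / 9)], and the factor 2
   still keeps [h y] below [e]. *)
have [||||r r0 rP] := @open_near_zeros _ (fun u => d x (g u))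
  [set b | exists a k, [/\ g a = x, `|a - b| < k &
                        forall w, `|a - w| < k -> d x (g w) < e / 9]].
- exact: dist_path_continuous.
- rewrite openE => b /= [a [k [ga ab kP]]]; apply/nbhs_ballP.
  exists (k - `|a - b|) => [|b' /= bb']; first by rewrite /= subr_gt0.
  exists a, k; split=> //; rewrite /ball /= in bb'.
  by have := ler_distD b a b'; lra.
- by move=> u _; exact: dist_ge0.
- move=> u _ /d_eq0 xu; have [k k0 kP] := gcont u e9.
  by exists u, k; rewrite subrr normr0 xu.
exists r => // y yx xy; have [b b01 gb] := gsurj y.
have [|a [k [ga ab kP]]] := rP _ b01; first by rewrite gb.
have [||h [c []]] := @slow_path_along a b (e / 9).
- by rewrite ga gb; exact: nesym.
- by move=> w aw; rewrite ga; apply/ltW/kP/(le_lt_trans aw).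
by rewrite ga gb => /((hcP y yx).2); lra.
Qed.

(** The points are lifted to parameters in [0, 1]; these have a cluster point [p], and [g p] is the
    limit. *)
Lemma complete_path_image (u : nat -> X) :
  (forall n m, d (u n) (u m) <= harmonic n + harmonic m) ->
  exists x, forall n, d (u n) x <= harmonic n.
Proof.
move=> cu; have lift n : exists v, 0 <= v <= 1 /\ g v = u n.
  by have [v v01 gv] := gsurj (u n); exists v.
have [a aP] := choice lift.
have [|p [_ clp]] := @segment_compact R 0 1 (a @ \oo) _.
  by exists 0%N => // n _ /=; rewrite in_itv /= (aP n).1.
exists (g p) => n; apply/ler_addgt0Pl => e e0.
have e20 : 0 < e / 2 by rewrite divr_gt0.
have [r r0 pr] := gcont p e20; have [N Ne] := harmonic_lt e20.
have [||_ [[m Nm <-] pm]] := clp (a @` [set m | (N <= m)%N]) (ball p r).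
- by exists N => // m Nm; exists m.
- exact: nbhsx_ballx.
have := pr _ pm; have := cu n m; have := @harmonic_anti R _ _ Nm.
have := d_tri (u n) (u m) (g p); rewrite (aP m).2 (d_sym (g p)); lra.
Qed.

End Paths.

(** * R-trees *)

Section Tree.
Context {R : realType} {T : metricType R}.
Local Notation d := (@mdist R T).
Hypotheses (geoT : geodesic_space T) (hypT : zero_hyperbolic T).

Ltac pt2 x y := pose proof (metric_sym x y); pose proof (mdist_ge0 x y).
Ltac pt3 x y z := pt2 x y; pt2 y z; pt2 x z;
  pose proof (metric_triangle x y z); pose proof (metric_triangle x z y);
  pose proof (metric_triangle y x z).

Lemma four_point w x y z :
  d x z + d w y <= d x y + d w z \/ d x z + d w y <= d y z + d w x.
Proof.
have := hypT w x y z; rewrite /Gromov_product ge_min.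
move=> /orP[]; pt2 w x; pt2 w y; pt2 w z; lra.
Qed.

(** Equality would put [t] on the segment from [x] to [y]. This is thus the relation of lying in one
    component of the complement of [t], expressed by distances. *)
Definition same_side (t x y : T) := d x y < d x t + d t y.

Lemma same_sideC t x y : same_side t x y -> same_side t y x.
Proof. rewrite /same_side; pt3 t x y; lra. Qed.

Lemma same_side_neq t x y : same_side t x y -> x <> t /\ y <> t.
Proof.
by rewrite /same_side => h; split => e; move: h; rewrite e mdistxx; lra.
Qed.

Lemma dist_pos x y : x <> y -> 0 < d x y.
Proof. by move=> /eqP; rewrite mdist_gt0. Qed.

Lemma same_sidexx t x : x <> t -> same_side t x x.
Proof. move=> /dist_pos; rewrite /same_side mdistxx; pt2 x t; lra. Qed.

Lemma same_side_trans t x y z :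
  same_side t x y -> same_side t y z -> same_side t x z.
Proof.
rewrite /same_side; pt3 t x y; pt3 t y z; case: (four_point t x y z); lra.
Qed.

Lemma not_same_side t x y : ~ same_side t x y <-> d x y = d x t + d t y.
Proof.
rewrite /same_side; pt3 t x y; split=> [/negP|->]; last by rewrite ltxx.
by rewrite -leNgt; lra.
Qed.

Lemma same_side_near t x y : d x y < d x t -> same_side t x y.
Proof. rewrite /same_side; pt2 t y; lra. Qed.

Lemma same_side_segment t x y : x <> t -> d t x + d x y = d t y -> same_side t x y.
Proof. move=> /dist_pos; rewrite /same_side; pt3 t x y; lra. Qed.

Lemma segment_point a b r : 0 <= r <= d a b ->
  exists2 c, d a c = r & d c b = d a b - r.
Proof.
move=> /andP[r0 rb]; have [g [g0 g1 giso]] := geoT a b.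
have L0 := mdist_ge0 a b.
exists (g r).
  rewrite -[X in d X _]g0 giso ?in_itv /= ?lexx ?r0 ?L0//.
  by rewrite sub0r normrN ger0_norm.
rewrite -[X in d _ X]g1 giso ?in_itv /= ?lexx ?r0 ?L0//.
by rewrite distrC ger0_norm// subr_ge0.
Qed.

Lemma segment_dist t e q w : d t q + d q e = d t e -> d t w + d w e = d t e ->
  d q w = `|d t q - d t w|.
Proof.
move=> tqe twe.
pose proof (metric_triangle t q w); pose proof (metric_triangle t w q).
pt2 q w; pt2 e w.
by case: (four_point t q e w); case: (lerP (d t w) (d t q)); lra.
Qed.

(* The hypotheses say that q is the projection of z to the segment [t, e]. *)
Lemma segment_projection t e z q : d t q + d q e = d t e ->
  2 * d t q = d t z + d t e - d z e ->
  d z q = d t z - d t q /\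
  forall w, d t w + d w e = d t e -> d z w = d z q + d q w.
Proof.
move=> tqe qz; have zq : d z q = d t z - d t q.
  pt2 z q; pt2 t q; pt2 q e.
  pose proof (metric_triangle t q z); case: (four_point t z e q); lra.
split=> // w twe; have wq := segment_dist tqe twe.
pose proof (metric_triangle z q w); pose proof (metric_triangle t w z).
pt2 z w; move: wq; case: (lerP (d t w) (d t q)) => ? ?.
  case: (four_point t z q w); lra.
case: (four_point t z w e); lra.
Qed.

(** Every side of [t] is open, and closed once [t] is added, so the side of [a] is clopen relative
    to [C]. *)
Lemma connected_same_side (C : set T) t a b :
  connected C -> ~ C t -> C a -> C b -> same_side t a b.
Proof.
move=> Cconn Ct Ca Cb.
have at_ : a <> t by move=> e; apply: Ct; rewrite -e.
have nbhsT (x : T) (A : set T) e : 0 < e -> (forall y, d x y < e -> A y) ->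
    nbhs x A.
  by move=> e0 xA; apply/nbhs_ballP; exists e => // y; rewrite ballEmdist; exact: xA.
have pos x : C x -> 0 < d x t by move=> Cx; apply: dist_pos => e; apply: Ct; rewrite -e.
suff /(congr1 (@^~ b)) : C `&` [set z | same_side t a z] = C.
  by move=> /= e; have [] : (C `&` [set z | same_side t a z]) b by rewrite /setI/= e.
apply: Cconn; first by exists a; split=> //; exact: same_sidexx.
  exists [set z | same_side t a z] => //; rewrite openE => z /= az.
  apply: (nbhsT _ _ (d z t)) => [|y zy].
    by apply: dist_pos; have [] := same_side_neq az.
  exact/(same_side_trans az)/same_side_near.
exists ([set z | same_side t a z] `|` [set t]).
  rewrite -[X in closed X]setCK; apply: open_closedC.
  rewrite openE => z /= zA.
  have zt : z <> t by move=> e; apply: zA; right.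
  apply: (nbhsT _ _ (d z t)) => [|y zy [ay|yt]]; first exact: dist_pos.
    by apply: zA; left; apply/(same_side_trans ay)/same_sideC/same_side_near.
  by move: zy; rewrite yt ltxx.
rewrite setIUr; apply/seteqP; split=> [z|z []//]; first by left.
by move=> [? zt]; case: Ct; rewrite -zt.
Qed.

(** The geodesic from [a] to [b] is connected and misses [t]. *)
Lemma same_side_component t a b : same_side t a b ->
  connected_component (~` [set t]) a = connected_component (~` [set t]) b.
Proof.
move=> ab; apply: same_connected_component.
have L0 := mdist_ge0 a b.
have [g [g0 g1 giso]] := geoT a b.
have in0 : (0 : R) \in `[0, d a b] by rewrite in_itv /= lexx.
have in1 : d a b \in `[0, d a b] by rewrite in_itv /= lexx L0.
exists (g @` `[0, d a b]); last by exists (d a b).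
split; first by exists 0.
  move=> _ [r r01 <-] /= gt; move: ab; apply/not_same_side.
  rewrite -gt -[X in d X _ = d X _ + _]g0 -[X in d _ X = _ + d _ X]g1 !giso//.
  move: r01; rewrite /= in_itv /= => /andP[r0 r1].
  by rewrite !sub0r !normrN (ger0_norm L0) (ger0_norm r0) distrC ger0_norm ?subr_ge0//; lra.
apply: connected_continuous_connected; first exact: segment_connected.
apply/subspace_continuousP => r /= rab W /nbhs_ballP[e /= e0 eW].
apply/nbhs_ballP; exists e => // s /= rs sab; apply: eW.
by rewrite ballEmdist /= giso.
Qed.

Lemma complete_seq (u : nat -> T) : complete_space T ->
  (forall n m, d (u n) (u m) <= harmonic n + harmonic m) ->
  exists x, forall n, d (u n) x <= harmonic n.
Proof.
move=> cT cu; have [x ux] : exists x : T, u @ \oo --> x.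
  apply: (cT (u @ \oo)) => A /=; rewrite -entourage_ballE => -[e /= e0 eA].
  have [N Ne] : exists n : nat, harmonic n < e / 2.
    by apply: harmonic_lt; rewrite divr_gt0.
  have Nle n : (N <= n)%N -> harmonic n < e / 2.
    by move=> /(@harmonic_anti R) Nn; exact: le_lt_trans Ne.
  exists ([set x | exists2 n, (N <= n)%N & x = u n], [set x | exists2 n, (N <= n)%N & x = u n]) => /=.
    by split; exists N => // n /= Nn; exists n.
  move=> [_ _] [/= [n Nn ->] [m Nm ->]]; apply: eA => /=.
  rewrite ballEmdist /=; have := cu n m; have := Nle _ Nn; have := Nle _ Nm; lra.
exists x => n; apply/ler_addgt0Pl => e e0.
have e20 : 0 < e / 2 by rewrite divr_gt0.
have [N _ Nx] : \forall m \near \oo, d x (u m) < e / 2.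
  have : nbhs x [set y | d x y < e / 2].
    by apply/nbhs_ballP; exists (e / 2) => // y; rewrite ballEmdist.
  exact: ux.
have [M Me] := harmonic_lt e20.
have := Nx (maxn N M) (leq_maxl _ _); have := cu n (maxn N M).
have := @harmonic_anti R M (maxn N M) (leq_maxr _ _).
have := metric_triangle (u n) (u (maxn N M)) x; pt2 x (u (maxn N M)).
lra.
Qed.

(** The sides of [t] correspond to the sets of naturals, and the Dedekind cut of a real, coded
    through the rationals, is such a set. A side whose set is no cut gets the label 0. *)
Lemma side_labels t : valency_continuum t ->
  exists rho : T -> R, (forall x y, same_side t x y -> rho x = rho y) /\
    forall v, exists2 x, x <> t & rho x = v.
Proof.
move=> /card_set_bijP[F [_ _ Fsurj]].
pose cut (r : R) := [set n | exists2 q : rat, unpickle n = Some q & ratr q < r].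
have cut_lt r r' : r < r' -> cut r <> cut r'.
  move=> /rat_in_itvoo[q]; rewrite in_itv /= => /andP[rq qr'] e.
  have : cut r (pickle q) by rewrite e; exists q => //; rewrite pickleK.
  by move=> [q']; rewrite pickleK => -[<-]; rewrite ltNge (ltW rq).
have cut_inj r r' : cut r = cut r' -> r = r'.
  by move=> e; case: (ltgtP r r') => // /cut_lt // /(_ (esym e)).
pose K x := connected_component (~` [set t]) x.
pose rho x := xget 0 [set r | cut r = F (K x)].
exists rho; split=> [x y xy|v].
  by rewrite /rho /K (same_side_component xy).
have [_ [x /= xt <-] FKx] := Fsurj (cut v) I.
exists x => //; apply: xget_unique => [|r] /=; rewrite FKx//; exact: cut_inj.
Qed.

(** * Long branches at every point *)

Hypothesis completeT : complete_space T.
Hypothesis valencyT : forall t : T, valency_continuum t.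

Lemma extend_segment t w : exists2 w', w' <> w & d t w' = d t w + d w w'.
Proof.
have [rho [rhoP rho_surj]] := side_labels (valencyT w).
(* A label other than that of [t] gives a side of [w] away from [t]. *)
have [w' w'w rhow'] := rho_surj (rho t + 1).
exists w' => //; apply/not_same_side => /rhoP; rewrite rhow'; lra.
Qed.

(** Were there no such point, the whole side of [z] would stay within distance [h]. Ordered by lying
    on the segment from [t], its points would then have a maximal one by Zorn's lemma and
    completeness, contrary to [extend_segment]. *)
Lemma long_branch t z (h : R) : z <> t -> 0 < h ->
  exists2 e, same_side t z e & d t e = h.
Proof.
move=> zt h0; apply: contrapT => noe.
have short w : same_side t z w -> d t w < h.
  move=> zw; rewrite ltNge; apply/negP => hw; apply: noe.
  have [|c tc cw] := @segment_point t w h; first by rewrite (ltW h0).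
  exists c => //; apply: (same_side_trans zw); apply/same_sideC/same_side_segment.
    by move=> ct; move: h0; rewrite -tc ct mdistxx ltxx.
  by rewrite tc cw; lra.
pose E x y := d t x + d x y = d t y.
have Etrans x y w : same_side t z y -> E x y -> E y w -> E x w.
  rewrite /E => _ xy yw; have := metric_triangle t x w; have := metric_triangle x y w; lra.
have [|A AP [a Aa] Atot|m zm mmax] :=
  @premaximal_on T [set w | same_side t z w] E z (same_sidexx zt) _ Etrans.
- by move=> x; rewrite /E mdistxx addr0.
- have ge0 := @harmonic_ge0 R; have gt0 := @harmonic_gt0 R.
  (* The points of a chain are lined up from [t], so points almost farthest from [t] form a Cauchy
     sequence; its limit bounds the chain. *)
  have nearmax n : exists x, A x /\ forall y, A y -> d t y <= d t x + harmonic n.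
    have [x Ax xmax] := @approx_max _ _ A (d t) h (harmonic n) (ex_intro _ a Aa)
      (fun x Ax => ltW (short _ (AP _ Ax))) (gt0 n).
    by exists x.
  have [u uP] := choice nearmax.
  have uA n := (uP n).1; have umax n := (uP n).2.
  have [|x ux] := @complete_seq u completeT.
    move=> n m; have := umax n _ (uA m); have := umax m _ (uA n).
    have := ge0 n; have := ge0 m; have := metric_sym (u n) (u m).
    by case: (Atot _ _ (uA n) (uA m)); rewrite /E; lra.
  have Ex w : A w -> E w x.
    move=> Aw; apply/eqP; rewrite eq_le metric_triangle andbT.
    apply: (@le_harmonic _ _ _ 4) => // n.
    have := ux n; have := umax n _ Aw; have := ge0 n.
    have := metric_sym w (u n); have := metric_triangle t x (u n).
    have := metric_triangle t (u n) x; have := metric_triangle w (u n) x.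
    have := metric_sym x (u n).
    by case: (Atot _ _ Aw (uA n)); rewrite /E; lra.
  exists x => //=; have za := AP _ Aa; apply: (same_side_trans za).
  exact: (same_side_segment (same_side_neq za).2 (Ex a Aa)).
- have [w wm tw] := extend_segment t m.
  have /mmax : same_side t z w.
    apply: (same_side_trans zm); apply: same_side_segment => //.
    exact: (same_side_neq zm).2.
  have := dist_pos wm; rewrite /E tw; pt2 m w => ? /(_ erefl); lra.
Qed.

(** * Partial maps on subtrees *)

Definition gate (S : set T) t s := S s /\ forall z, S z -> d t z = d t s + d s z.

Lemma gate_unique S t s s' : gate S t s -> gate S t s' -> s = s'.
Proof.
move=> [Ss gs] [Ss' gs']; apply/mdist_positivity.
have := gs _ Ss'; have := gs' _ Ss; pt2 s s'; lra.
Qed.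

Lemma gate_refl S t : S t -> gate S t t.
Proof. by move=> St; split=> // z _; rewrite mdistxx add0r. Qed.

Lemma gate_mem S t s : S t -> gate S t s -> s = t.
Proof. by move=> St /gate_unique; apply; exact: gate_refl. Qed.

Lemma gate_lipschitz S t t' s s' : gate S t s -> gate S t' s' -> d s s' <= d t t'.
Proof.
move=> [Ss gs] [Ss' gs']; have := gs _ Ss'; have := gs' _ Ss; pt2 s s'.
pt2 t t'; have := metric_triangle t t' s'; have := metric_triangle t' t s; lra.
Qed.

Lemma gate_dist_le S t s z : gate S t s -> S z -> d t s <= d t z.
Proof. by move=> [_ gs] /gs ->; rewrite lerDl mdist_ge0. Qed.

Lemma gate_sub (S S' : set T) t s s' : S `<=` S' ->
  gate S' t s' -> gate S t s -> gate S s' s.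
Proof.
move=> SS' [S's' gs'] [Ss gs]; split=> // z Sz.
have := gs _ Sz; have := gs' _ (SS' _ Sz); have := gs' _ (SS' _ Ss); lra.
Qed.

Context {X : Type} (dX : X -> X -> R).
Hypothesis dX_eq0 : forall x y, dX x y = 0 <-> x = y.
Hypothesis dX_sym : forall x y, dX x y = dX y x.
Hypothesis dX_tri : forall x y z, dX x z <= dX x y + dX y z.
Variable g : R -> X.
Hypothesis gcont : continuous_path dX g.
Hypothesis gsurj : forall x, exists2 a, 0 <= a <= 1 & g a = x.

(** In this order, the clauses serve to make the domain reach every side of [t], the map open at
    [t], and the map onto. *)
Definition saturated (S : set T) (f : T -> X) t :=
  [/\ forall z, z <> t -> exists2 w, S w & same_side t z w,
      forall e, 0 < e -> exists2 r, 0 < r &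
        forall y, dX (f t) y < r -> exists w, [/\ S w, d t w < e & f w = y]
    & forall y, exists2 w, S w & f w = y].

(** A point of an attached arc sees the domain only towards the root and towards the tip of the arc;
    the bound two is encoded by three points. *)
Definition few_sides (S : set T) t := forall w1 w2 w3,
  S w1 -> S w2 -> S w3 -> w1 <> t -> w2 <> t -> w3 <> t ->
  [\/ same_side t w1 w2, same_side t w1 w3 | same_side t w2 w3].

Definition nonconstant_on (S : set T) (f : T -> X) a b := exists c c',
  [/\ S c /\ S c', d a c + d c b = d a b, d a c' + d c' b = d a b & f c <> f c'].

(** The alternative in [pm_sides] keeps enough free branches at each point not yet treated.
    [pm_light] yields lightness because a connected set contains the segments between its points. *)
Record partial_map (P : set T * (T -> X)) : Prop := PartialMap {
  pm_gate : forall t, exists s, gate P.1 t s;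
  pm_cont : forall t e, P.1 t -> 0 < e -> exists2 r, 0 < r &
    forall w, P.1 w -> d t w < r -> dX (P.2 t) (P.2 w) < e;
  pm_light : forall a b, P.1 a -> P.1 b -> a <> b -> nonconstant_on P.1 P.2 a b;
  pm_sides : forall t, P.1 t -> saturated P.1 P.2 t \/ few_sides P.1 t }.

(* The last condition is the only metric control, and it is one that passes to
   compositions and to limits of chains. *)
Definition extends (P Q : set T * (T -> X)) :=
  [/\ P.1 `<=` Q.1, forall t, P.1 t -> Q.2 t = P.2 t
    & forall t s, Q.1 t -> gate P.1 t s -> dX (Q.2 t) (P.2 s) <= d t s].

Lemma extends_refl P : extends P P.
Proof.
split=> // t s Pt /(gate_mem Pt) ->.
by rewrite (dist_xx dX_eq0) mdist_ge0.
Qed.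

(** The gate of [t] in [P] is reached by way of its gate [q] in [Q], so the two bounds add up to the
    distance. *)
Lemma extends_trans P Q W : partial_map Q -> extends P Q -> extends Q W ->
  extends P W.
Proof.
move=> pQ [PQ PQE PQd] [QW QWE QWd]; split.
- exact: subset_trans PQ QW.
- by move=> t Pt; rewrite QWE ?PQE//; exact: PQ.
- move=> t s Wt ts; have [q tq] := pm_gate pQ t.
  have qs := gate_sub PQ tq ts.
  have := QWd _ _ Wt tq; have := PQd _ _ tq.1 qs.
  have := dX_tri (W.2 t) (Q.2 q) (P.2 s).
  by rewrite (tq.2 s (PQ _ ts.1)); lra.
Qed.

Lemma saturated_extends P Q t : extends P Q -> P.1 t ->
  saturated P.1 P.2 t -> saturated Q.1 Q.2 t.
Proof.
move=> [PQ PQE _] Pt [H1 H2 H3]; split.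
- by move=> z /H1[w Pw zw]; exists w => //; exact: PQ.
- move=> e /H2[r r0 rP]; exists r => // y; rewrite PQE// => /rP[w [Pw tw <-]].
  by exists w; rewrite PQE//; split=> //; exact: PQ.
- by move=> y; have [w Pw <-] := H3 y; exists w; rewrite ?PQE//; exact: PQ.
Qed.

(** * Upper bounds of chains *)

Section Chain.
Variable A : set (set T * (T -> X)).
Hypotheses (Apm : A `<=` partial_map) (A0 : A !=set0) (Atot : total_on A extends).

Let G (P : set T * (T -> X)) t := xget t (gate P.1 t).

Let GP P t : A P -> gate P.1 t (G P t).
Proof.
by move=> /Apm/pm_gate/(_ t)[s ts]; rewrite /G; apply: xgetPex; exists s.
Qed.

(** This is the closure of the union of the domains, taken so that gates exist. *)
Let S : set T := [set t | forall e, 0 < e -> exists2 P, A P & d t (G P t) < e].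

Let G_mono P Q t : extends P Q -> A P -> A Q ->
  d t (G P t) = d t (G Q t) + d (G Q t) (G P t).
Proof. by move=> [PQ _ _] AP AQ; apply: (GP t AQ).2; apply/PQ; case: (GP t AP). Qed.

(** As [P] grows, its gate moves along a segment towards [t]. Members that almost minimize the
    distance give a Cauchy sequence of gates, whose limit is the gate in [S]. *)
Let chain_gate t : exists2 s, gate S t s &
  forall P, A P -> d t (G P t) = d t s + d s (G P t).
Proof.
have ge0 := @harmonic_ge0 R; have gt0 := @harmonic_gt0 R.
have near n : exists P, A P /\ forall Q, A Q -> d t (G P t) <= d t (G Q t) + harmonic n.
  have [|P AP Pmin] := @approx_max _ _ A (fun P => - d t (G P t)) 0 (harmonic n)
    A0 _ (gt0 n).
    by move=> P _; rewrite oppr_le0 mdist_ge0.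
  by exists P; split=> // Q /Pmin; lra.
have [P PP] := choice near.
have AP n := (PP n).1; have Pmin n := (PP n).2.
have [|s us] := @complete_seq (fun n => G (P n) t) completeT.
  move=> n m; have := Pmin n _ (AP m); have := Pmin m _ (AP n).
  have := ge0 n; have := ge0 m; pt2 (G (P n) t) (G (P m) t).
  by case: (Atot (AP n) (AP m)) => /(@G_mono _ _ t) mono;
    [have := mono (AP n) (AP m)|have := mono (AP m) (AP n)]; lra.
have tsE Q : A Q -> d t (G Q t) = d t s + d s (G Q t).
  move=> AQ; apply/eqP; rewrite eq_le metric_triangle /=.
  apply: (@le_harmonic _ _ _ 4) => // n.
  have := us n; have := Pmin n _ AQ; have := ge0 n.
  pt2 s (G (P n) t); pt2 (G Q t) (G (P n) t).
  have := metric_triangle t (G (P n) t) s.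
  have := metric_triangle s (G (P n) t) (G Q t).
  by case: (Atot AQ (AP n)) => /(@G_mono _ _ t) mono;
    [have := mono AQ (AP n)|have := mono (AP n) AQ]; lra.
exists s => //; split=> [e e0|z Sz].
  have [n ne] := harmonic_lt e0; exists (P n) => //; apply: le_lt_trans ne.
  apply: le_trans (us n); rewrite [leRHS]metric_sym.
  exact: gate_dist_le (GP s (AP n)) (GP t (AP n)).1.
apply/eqP; rewrite eq_le metric_triangle /=; apply/ler_addgt0Pl => e e0.
have e20 : 0 < e / 2 by rewrite divr_gt0.
have [Q AQ zQ] := Sz _ e20; have [Qz' gz'] := GP z AQ.
have := (GP t AQ).2 _ Qz'; have := tsE _ AQ.
have := metric_triangle s (G Q t) (G Q z).
have := metric_triangle s (G Q z) z; have := metric_triangle t z (G Q z).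
pt2 z (G Q z); lra.
Qed.

Let mem_S P t : A P -> P.1 t -> S t.
Proof.
by move=> AP Pt e e0; exists P; rewrite // (gate_mem Pt (GP t AP)) mdistxx.
Qed.

Let chain_dist P Q t : extends P Q -> A P -> A Q ->
  dX (Q.2 (G Q t)) (P.2 (G P t)) <= d t (G P t).
Proof.
move=> PQ AP AQ; have [PQs _ PQd] := PQ; have [QG _] := GP t AQ.
apply: le_trans (PQd _ _ QG (gate_sub PQs (GP t AQ) (GP t AP))) _.
by rewrite (G_mono t PQ AP AQ) lerDr mdist_ge0.
Qed.

(** The value is the limit of the values at the gates of [t], which are Cauchy by the last clause of
    [extends]. Outside [S] it is arbitrary. *)
Let chain_value t : exists x, S t ->
  forall P, A P -> dX x (P.2 (G P t)) <= d t (G P t).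
Proof.
have [St|nSt] := pselect (S t); last by exists (g 0).
have ge0 := @harmonic_ge0 R; have gt0 := @harmonic_gt0 R.
have near n : exists P, A P /\ d t (G P t) < harmonic n.
  by have [P AP tP] := St _ (gt0 n); exists P.
have [P PP] := choice near; have AP n := (PP n).1; have tP n := (PP n).2.
have [|x ux] := @complete_path_image _ _ dX dX_sym dX_tri g gcont gsurj
    (fun n => (P n).2 (G (P n) t)).
  move=> n m; have := tP n; have := tP m; have := ge0 n; have := ge0 m.
  case: (Atot (AP n) (AP m)) => PQ.
    have := chain_dist t PQ (AP n) (AP m); rewrite dX_sym; lra.
  by have := chain_dist t PQ (AP m) (AP n); lra.
exists x => _ Q AQ; apply: (@le_harmonic _ _ _ 2) => // n.
have := ux n; have := tP n; rewrite (dX_sym _ x).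
have := dX_tri x ((P n).2 (G (P n) t)) (Q.2 (G Q t)).
case: (Atot AQ (AP n)) => PQ.
  by have := chain_dist t PQ AQ (AP n); have := ge0 n; lra.
have := chain_dist t PQ (AP n) AQ; have := mdist_ge0 t (G Q t).
by rewrite (dX_sym (Q.2 _)); lra.
Qed.

(** Three points are what [few_sides] calls for. Passing to a larger member never moves a gate away
    from its point. *)
Let chain_near t1 t2 t3 e : S t1 -> S t2 -> S t3 -> 0 < e ->
  exists P, [/\ A P, d t1 (G P t1) < e, d t2 (G P t2) < e &
               d t3 (G P t3) < e].
Proof.
move=> S1 S2 S3 e0; have [P0 AP0] := A0.
have step P t : A P -> S t -> exists Q, [/\ A Q, extends P Q & d t (G Q t) < e].
  move=> AP /(_ e e0)[Q AQ tQ]; case: (Atot AP AQ) => PQ; first by exists Q.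
  exists P; split; [by []|exact: extends_refl|].
  by apply: le_lt_trans tQ; rewrite (G_mono t PQ AQ AP) lerDl mdist_ge0.
have mono P Q t : A P -> A Q -> extends P Q -> d t (G P t) < e -> d t (G Q t) < e.
  move=> AP AQ PQ; apply: le_lt_trans.
  by rewrite (G_mono t PQ AP AQ) lerDl mdist_ge0.
have [P1 [AP1 _ tP1]] := step P0 t1 AP0 S1.
have [P2 [AP2 PP2 tP2]] := step P1 t2 AP1 S2.
have [P3 [AP3 PP3 tP3]] := step P2 t3 AP2 S3.
exists P3; split=> //; last exact: mono tP2.
by apply: mono tP1 => //; apply: extends_trans PP3 => //; exact: Apm.
Qed.

Lemma chain_bound : exists2 Q, partial_map Q & forall P, A P -> extends P Q.
Proof.
have [f fP] := choice chain_value; pose Q : set T * (T -> X) := (S, f).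
have fE P t : A P -> P.1 t -> f t = P.2 t.
  move=> AP Pt; apply/dX_eq0/eqP; rewrite eq_le (dist_ge0 dX_eq0 dX_sym dX_tri) andbT.
  have := fP _ (mem_S AP Pt) _ AP; rewrite (gate_mem Pt (GP t AP)).
  by rewrite mdistxx.
have ext P : A P -> extends P Q.
  move=> AP; split=> [t /(mem_S AP)//|t|t s St ts]; first exact: fE.
  by rewrite (gate_unique ts (GP t AP)); exact: fP.
exists Q => //; split=> /= [t|t e St e0|a b Sa Sb ab|t St].
- by have [s ts _] := chain_gate t; exists s.
(* Four fifths are used: one from [t] to its gate, one between the values at the two gates, two from
   [w] to its gate. *)
- have e5 : 0 < e / 5 by rewrite divr_gt0.
  have [P AP tP] := St _ e5; have Ps := (GP t AP).1.
  have [r r0 rP] := pm_cont (Apm AP) Ps e5.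
  exists (Num.min r (e / 5)) => [|w Sw]; first by rewrite lt_min r0.
  rewrite lt_min => /andP[twr twe].
  have := gate_lipschitz (GP t AP) (GP w AP) => /le_lt_trans/(_ twr).
  move=> /(rP _ (GP w AP).1); have := fP _ St _ AP; have := fP _ Sw _ AP.
  have := gate_dist_le (GP w AP) Ps; have := metric_triangle w t (G P t).
  have := dX_tri (f t) (P.2 (G P t)) (f w).
  have := dX_tri (P.2 (G P t)) (P.2 (G P w)) (f w).
  rewrite (dX_sym (P.2 (G P w))); pt2 t w; lra.
(* Gates within half of [d a b] are distinct, and the segment between them is part of the segment
   from [a] to [b]. *)
- have ab0 : 0 < d a b / 2 by rewrite divr_gt0// dist_pos.
  have [P [AP aP bP _]] := chain_near Sa Sb Sb ab0.
  have [Pa' ga] := GP a AP; have [Pb' gb] := GP b AP.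
  move: (G P a) (G P b) aP bP Pa' ga Pb' gb => a' b' aP bP Pa' ga Pb' gb.
  have a'b' : a' <> b'.
    move=> e; move: aP bP; rewrite e; have := metric_triangle a b' b.
    pt2 b b'; lra.
  have nab : ~ same_side a' a b.
    move=> ab'; have : same_side a' a b'.
      apply: (same_side_trans ab'); rewrite /same_side.
      have := gb _ Pa'; have := dist_pos a'b'; pt2 b a'; pt2 b' a'; lra.
    by apply/not_same_side; exact: ga.
  move: nab => /not_same_side abE.
  have abE' : d a b = d a a' + d a' b' + d b' b.
    by have := gb _ Pa'; pt2 b a'; pt2 b b'; pt2 a' b'; lra.
  have seg c : d a' c + d c b' = d a' b' -> d a c + d c b = d a b.
    move=> ce; have := metric_triangle a a' c; have := metric_triangle c b' b.
    have := metric_triangle a c b; lra.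
  have [c [c' [[Pc Pc'] ca cb ncc']]] := pm_light (Apm AP) Pa' Pb' a'b'.
  exists c, c'; split; [by split; apply: mem_S AP _|exact: seg|exact: seg|].
  by rewrite !(fE P).
(* If no member of the chain saturates [t], the three points are replaced by their gates in one
   member, which lie on the same sides of [t]. *)
- have [[P [AP Pt satP]]|nsat] :=
    pselect (exists P, [/\ A P, P.1 t & saturated P.1 P.2 t]).
    by left; exact: (saturated_extends (ext P AP)).
  right=> w1 w2 w3 S1 S2 S3 w1t w2t w3t.
  pose e := Num.min (d w1 t) (Num.min (d w2 t) (d w3 t)).
  have e0 : 0 < e by rewrite !lt_min !dist_pos.
  have [P [AP t1 t2 t3]] := chain_near S1 S2 S3 e0.
  move: t1 t2 t3; rewrite !lt_min => /andP[t1 _] /and3P[_ t2 _] /and3P[_ _ t3].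
  have side w : d w (G P w) < d w t -> same_side t w (G P w).
    exact: same_side_near.
  have [Pt|nPt] := pselect (P.1 t).
    have [?|few] := pm_sides (Apm AP) Pt; first by case: nsat; exists P.
    have [s1 s2 s3] := And3 (side _ t1) (side _ t2) (side _ t3).
    have := few _ _ _ (GP w1 AP).1 (GP w2 AP).1 (GP w3 AP).1
      (same_side_neq s1).2 (same_side_neq s2).2 (same_side_neq s3).2.
    by case=> h; [constructor 1|constructor 2|constructor 3];
      apply: same_side_trans (same_side_trans h (same_sideC _)).
  (* When [t] is outside the domain of [P], all of that domain lies on the side of [t] that contains
     the gate of [t]. *)
  constructor 1; have [Pt' gt'] := GP t AP.
  have t't : G P t <> t by move=> e'; apply: nPt; rewrite -e'.
  have side' w : d w (G P w) < d w t -> same_side t w (G P t).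
    move=> /side ww; apply: (same_side_trans ww); apply/same_sideC.
    by apply: same_side_segment => //; rewrite -gt' //; case: (GP w AP).
  exact: same_side_trans (side' _ t1) (same_sideC (side' _ t2)).
Qed.

End Chain.

(** * Attaching arcs *)

Section Saturate.
Variables (S : set T) (f : T -> X) (t0 : T).
Hypotheses (pmP : partial_map (S, f)) (St0 : S t0) (few : few_sides S t0).
Variables (h : X -> R) (c : X -> R -> X).
Hypothesis slow : forall y, y <> f t0 -> slow_path dX (f t0) y (h y) (c y).
Hypothesis short : forall e, 0 < e -> exists2 r, 0 < r &
  forall y, y <> f t0 -> dX (f t0) y < r -> h y < e.
Variable lab : T -> X.
Hypothesis lab_neq : forall z, lab z <> f t0.
Hypothesis lab_side : forall z w, same_side t0 z w -> lab z = lab w.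
Hypothesis lab_surj : forall y, y <> f t0 -> exists z1 z2 z3,
  [/\ z1 <> t0, z2 <> t0 & z3 <> t0] /\
  [/\ lab z1 = y, lab z2 = y & lab z3 = y] /\
  [/\ ~ same_side t0 z1 z2, ~ same_side t0 z1 z3 & ~ same_side t0 z2 z3].

Let free z := z <> t0 /\ forall w, S w -> ~ same_side t0 z w.

(** All points of one side must share the end of their arc. They do, because [xget] depends only on
    the set, which is the same for them ([tip_side]). *)
Let tip z := xget t0 [set e | same_side t0 z e /\ d t0 e = h (lab z)].

Let arc z := free z /\ d t0 z + d z (tip z) = d t0 (tip z).

Let h_gt0 z : 0 < h (lab z). Proof. by have [[]] := slow (@lab_neq z). Qed.

Let tipP z : z <> t0 -> same_side t0 z (tip z) /\ d t0 (tip z) = h (lab z).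
Proof.
move=> zt; have [e ze te] := long_branch zt (h_gt0 z).
exact: (xgetPex t0 (ex_intro [set e | _ /\ _] e (conj ze te))).
Qed.

Let tip_side z w : same_side t0 z w -> tip z = tip w.
Proof.
move=> zw; rewrite /tip (lab_side zw); congr xget; apply/seteqP.
split=> e [ze te]; split=> //.
  exact: same_side_trans (same_sideC zw) ze.
exact: same_side_trans zw ze.
Qed.

Let free_side z w : free z -> same_side t0 z w -> free w.
Proof.
move=> [_ zS] zw; split; first exact: (same_side_neq zw).2.
by move=> u /zS zu wu; apply/zu/(same_side_trans zw).
Qed.

Let free_S z w : free z -> S w -> d z w = d z t0 + d t0 w.
Proof. by move=> [_ zS] /zS /not_same_side. Qed.

Let free_notS z : free z -> ~ S z.
Proof. by move=> [zt zS] /zS; apply; exact: same_sidexx. Qed.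

Let arc_tip z : free z -> arc (tip z).
Proof.
move=> fz; have [ze _] := tipP fz.1; split; first exact: free_side fz ze.
by rewrite -(tip_side ze) mdistxx addr0.
Qed.

Let arc_le z : arc z -> 0 <= d t0 z <= h (lab z).
Proof.
move=> [fz ez]; have [_ te] := tipP fz.1.
by rewrite mdist_ge0 -te -ez lerDl mdist_ge0.
Qed.

Let S' : set T := S `|` arc.
Let f' z := if `[< S z >] then f z else c (lab z) (d t0 z).

Let f'S z : S z -> f' z = f z. Proof. by rewrite /f' => /asboolP ->. Qed.

Let f'arc z : arc z -> f' z = c (lab z) (d t0 z).
Proof. by move=> [/free_notS nS _]; rewrite /f'; case: asboolP. Qed.

Let f'arc_le z : arc z -> dX (f t0) (f' z) <= d t0 z.
Proof.
move=> az; rewrite f'arc//; have [_ H _ _] := slow (@lab_neq z).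
exact/H/arc_le.
Qed.

Let arc_side z w : S' w -> free z -> same_side t0 z w -> arc w.
Proof. by move=> [Sw|//] [_ /(_ _ Sw)]. Qed.

Let arc_segment z w : arc z -> w <> t0 -> d t0 w + d w z = d t0 z -> arc w.
Proof.
move=> [fz ez] wt wz; have ww := same_side_segment wt wz.
split; first exact: (free_side fz (same_sideC ww)).
rewrite (tip_side ww); have := metric_triangle t0 w (tip z).
have := metric_triangle w z (tip z); lra.
Qed.

Let attach_gate z : exists s, gate S' z s.
Proof.
have [s [Ss gs]] := pm_gate pmP z; rewrite /= in Ss gs.
(* A gate other than [t0] is kept: [z] is then on a side of [t0] met by [S], and every new arc is
   reached from [z] through [t0]. *)
have [st|st] := pselect (s = t0); last first.
  exists s; split=> [|w [/gs//|[fw ew]]]; first by left.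
  have zs : same_side t0 z s.
    rewrite /same_side (gs _ St0); have := dist_pos st; pt2 s t0; lra.
  have zw : d z w = d z t0 + d t0 w.
    by apply/not_same_side => /same_sideC/same_side_trans/(_ zs); exact: fw.2.
  have := free_S fw Ss; have := gs _ St0; pt2 s w; pt2 w t0; pt2 s t0; lra.
subst s; have [->|zt] := pselect (z = t0).
  by exists t0; apply: gate_refl; left.
have fz : free z by split=> // w /gs; move/not_same_side.
have [ze te] := tipP zt; set e := tip z in ze te.
(* [r] is the Gromov product of [z] and [e] at [t0], so [q] is the projection of [z] to the arc. *)
pose r := (d t0 z + d t0 e - d z e) / 2.
have [|q tq qe] := @segment_point t0 e r.
  rewrite /r; move: ze; rewrite /same_side; pt2 z t0; have := metric_triangle t0 z e.
  by have := metric_triangle t0 e z; pt2 z e; lra.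
have r0 : 0 < r.
  by rewrite /r; move: ze; rewrite /same_side; pt2 z t0; lra.
have qt : q <> t0 by move=> q0; move: r0; rewrite -tq q0 mdistxx ltxx.
have tqe : d t0 q + d q e = d t0 e by lra.
have qe_side := same_side_segment qt tqe.
have aq : arc q by apply: arc_segment tqe => //; exact: arc_tip.
have [zq zproj] : d z q = d t0 z - d t0 q /\
    forall w, d t0 w + d w e = d t0 e -> d z w = d z q + d q w.
  by apply: segment_projection => //; rewrite tq /r; lra.
exists q; split=> [|w S'w]; first by right.
have [zw|/not_same_side zw] := pselect (same_side t0 z w).
  have [fw ew] := arc_side S'w fz zw; apply: zproj.
  by rewrite /e (tip_side zw).
have : ~ same_side t0 q w.
  move=> qw; move/not_same_side: zw; apply.
  by apply: same_side_trans qw; apply: (same_side_trans ze); exact: same_sideC.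
by move=> /not_same_side; pt2 q t0; pt2 z t0; lra.
Qed.

Let attach_cont t e : S' t -> 0 < e -> exists2 r, 0 < r &
  forall w, S' w -> d t w < r -> dX (f' t) (f' w) < e.
Proof.
have [St|nSt] := pselect (S t); move=> S't e0.
  have e20 : 0 < e / 2 by rewrite divr_gt0.
  have [r r0 rP] := pm_cont pmP St e20.
  exists (Num.min r (e / 2)) => [|w]; first by rewrite lt_min r0.
  rewrite lt_min => -[Sw|aw] /andP[twr twe].
    by rewrite !f'S//; have := rP _ Sw twr; rewrite /=; lra.
  (* The arc point [w] is reached from [t] through [t0]: continuity on [S] takes care of [t0], and
     the slow start of the arc of the rest. *)
  rewrite f'S//; have := f'arc_le aw; have := free_S aw.1 St.
  pt2 t w; pt2 w t0; pt2 t t0 => tw fw.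
  have /= := rP _ St0; have := dX_tri (f t) (f t0) (f' w).
  move=> tri near; have /near : d t t0 < r by lra.
  by lra.
have [//|at_] := S't; have lab_t := slow (@lab_neq t).
have [_ _ ccont _] := lab_t; have [r r0 rP] := ccont _ _ (arc_le at_) e0.
have tt0 := dist_pos at_.1.1.
(* The ball of radius [d t t0] stays on the side of [t], so it meets neither [S] nor another arc. *)
exists (Num.min r (d t t0)) => [|w S'w]; first by rewrite lt_min r0.
rewrite lt_min => /andP[twr /same_side_near tw].
have aw := arc_side S'w at_.1 tw.
rewrite !f'arc// -(lab_side tw); apply: rP.
  by rewrite (lab_side tw); exact: arc_le.
apply: le_lt_trans twr; rewrite ler_distlC; apply/andP; split.
  by have := metric_triangle t0 w t; pt2 t w; lra.
by have := metric_triangle t0 t w; lra.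
Qed.

(* The slow path is not constant along the part of the arc to b between the
   distances u and d t0 b from t0. *)
Let arc_nonconstant a b u : arc b -> 0 <= u < d t0 b ->
  (forall q, u <= d t0 q -> d t0 q + d q b = d t0 b ->
     d a q + d q b = d a b) ->
  nonconstant_on S' f' a b.
Proof.
move=> ab /andP[u0 ub] seg; have [_ bh] := andP (arc_le ab).
have [[h0 c0 _] _ _ nonc] := slow (@lab_neq b).
have [r [r' [/andP[ur rb] /andP[ur' r'b] rr']]] := nonc _ _ u0 ub bh.
have pt s : u <= s -> s <= d t0 b -> exists q,
    [/\ S' q, d t0 q = s, d t0 q + d q b = d t0 b & f' q = c (lab b) s].
  move=> us sb; have [|q tq qb] := @segment_point t0 b s.
    by rewrite (le_trans u0 us).
  have tqb : d t0 q + d q b = d t0 b by lra.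
  exists q; have [qt|qt] := pselect (q = t0).
    have s0 : s = 0 by rewrite -tq qt mdistxx.
    by rewrite tqb tq qt f'S// s0 c0; split=> //; left.
  have aq := arc_segment ab qt tqb; split=> //; first by right.
  by rewrite f'arc// (lab_side (same_side_segment qt tqb)) tq.
have [q [Sq tq qb fq]] := pt r ur rb.
have [q' [Sq' tq' qb' fq']] := pt r' ur' r'b.
exists q, q'; split; rewrite ?fq ?fq'//; apply: seg => //; first by rewrite tq.
by rewrite tq'.
Qed.

Let nonconstant_sym a b : nonconstant_on S' f' a b -> nonconstant_on S' f' b a.
Proof.
move=> [x [y [SS ax ay xy]]]; exists x, y; split=> //.
  by rewrite (metric_sym b x) (metric_sym x a) addrC ax metric_sym.
by rewrite (metric_sym b y) (metric_sym y a) addrC ay metric_sym.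
Qed.

(** Between an arc point and a point on another side of [t0] lies the arc from [t0] on; between two
    points of one arc lies a piece of it. In both cases a slow path runs there, constant on no
    interval. *)
Let attach_light a b : S' a -> S' b -> a <> b -> nonconstant_on S' f' a b.
Proof.
have apart x y : arc y -> ~ same_side t0 x y -> nonconstant_on S' f' x y.
  move=> ay /not_same_side xy; apply: (@arc_nonconstant _ _ 0) => //.
    by rewrite lexx dist_pos//; exact: nesym ay.1.1.
  move=> q _ tq; have := metric_triangle x t0 q; have := metric_triangle x q y; lra.
have together x y : arc x -> arc y -> same_side t0 x y -> d t0 x < d t0 y ->
    nonconstant_on S' f' x y.
  move=> ax ay xy lt; apply: (@arc_nonconstant _ _ (d t0 x)) => //.
    by rewrite lt mdist_ge0.
  move=> q xq tq; have ty := ay.2; have tx := ax.2; rewrite (tip_side xy) in tx.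
  have tqe : d t0 q + d q (tip y) = d t0 (tip y).
    have := metric_triangle t0 q (tip y); have := metric_triangle q y (tip y); lra.
  rewrite (segment_dist tx tqe) (segment_dist tx ty).
  by case: (lerP (d t0 q) (d t0 x)); case: (lerP (d t0 y) (d t0 x)); lra.
move=> Sa Sb ab.
have [Sa1|aa] := Sa; have [Sb1|ab1] := Sb.
- have [x [y [[Sx Sy] ax ay xy]]] := pm_light pmP Sa1 Sb1 ab.
  by exists x, y; rewrite !f'S//; split=> //; split; left.
- by apply: apart => //; move=> /same_sideC; exact: ab1.1.2.
- by apply/nonconstant_sym/apart => //; move=> /same_sideC; exact: aa.1.2.
have [sab|nsab] := pselect (same_side t0 a b); last exact: apart.
have [lt|lt|eq] := ltgtP (d t0 a) (d t0 b).
- exact: together.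
- by apply/nonconstant_sym/together => //; exact: same_sideC.
case: ab; apply: mdist_positivity; rewrite (@segment_dist t0 (tip b)).
- by rewrite eq subrr normr0.
- by have := aa.2; rewrite (tip_side sab).
- exact: ab1.2.
Qed.

(** Three sides carry the label [y], and [S] meets at most two of them. *)
Let free_label y : y <> f t0 -> exists2 z, free z & lab z = y.
Proof.
move=> /lab_surj[z1 [z2 [z3 [[n1 n2 n3] [[l1 l2 l3] [s12 s13 s23]]]]]].
apply: contrapT => nofree.
have meets z : z <> t0 -> lab z = y -> exists2 w, S w & same_side t0 z w.
  move=> zt zy; apply: contrapT => nw; apply: nofree; exists z => //.
  by split=> // w Sw zw; apply: nw; exists w.
have [w1 S1 zw1] := meets _ n1 l1; have [w2 S2 zw2] := meets _ n2 l2.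
have [w3 S3 zw3] := meets _ n3 l3.
have link z w z' w' : same_side t0 z w -> same_side t0 z' w' ->
    same_side t0 w w' -> same_side t0 z z'.
  move=> zw z'w' ww'; apply: (same_side_trans zw); apply: (same_side_trans ww').
  exact: same_sideC.
have [h12|h13|h23] := few S1 S2 S3 (same_side_neq zw1).2 (same_side_neq zw2).2
  (same_side_neq zw3).2.
- exact/s12/(link _ _ _ _ zw1 zw2).
- exact/s13/(link _ _ _ _ zw1 zw3).
- exact/s23/(link _ _ _ _ zw2 zw3).
Qed.

Let attach_saturated : saturated S' f' t0.
Proof.
(* The target [y] is attained at the tip of an arc, whose distance [h y] is small when [y] is near
   [f t0]. *)
have hit y : y <> f t0 -> exists w, [/\ S' w, d t0 w = h y & f' w = y].
  move=> /free_label[z fz <-]; have [ze te] := tipP fz.1.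
  have az := arc_tip fz; exists (tip z); split=> //; first by right.
  by rewrite f'arc// te -(lab_side ze); have [[]] := slow (@lab_neq z).
split=> [z zt|e e0|y].
- have [[w Sw zw]|nw] := pselect (exists2 w, S w & same_side t0 z w).
    by exists w => //; left.
  have fz : free z by split=> // w Sw zw; apply: nw; exists w.
  by exists (tip z); [right; exact: arc_tip|case: (tipP zt)].
- have [r r0 rP] := short e0; exists r => // y; rewrite f'S// => yr.
  have [->|yx] := pselect (y = f t0).
    by exists t0; rewrite mdistxx f'S//; split=> //; left.
  have [w [Sw tw fw]] := hit _ yx; exists w; split=> //.
  by rewrite tw; exact: rP.
- have [->|/hit[w [Sw _ fw]]] := pselect (y = f t0); last by exists w.
  by exists t0; [left|rewrite f'S].
Qed.

(** The gate in [S] of an arc point is [t0], so the required bound is the slow start. *)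
Let attach_extends : extends (S, f) (S', f').
Proof.
split=> [t St|t St|t s /= S't ts]; [by left|exact: f'S|].
have [St|nSt] := pselect (S t).
  by rewrite (gate_mem St ts) f'S// (dist_xx dX_eq0) mdist_ge0.
case: S't => // at_; have -> : s = t0.
  apply: gate_unique ts _; split=> // z; exact: free_S at_.1.
by rewrite dX_sym (metric_sym t); exact: f'arc_le.
Qed.

Let attach_sides t : S' t -> saturated S' f' t \/ few_sides S' t.
Proof.
move=> S't; have [->|tt0] := pselect (t = t0); first by left.
have [St|nSt] := pselect (S t).
  have [sat|few'] := pm_sides pmP St; first by left; exact: (saturated_extends attach_extends St sat).
  (* Seen from another point of [S], the new arcs lie on the side of [t0], which [S] already
     meets. *)
  right; have toS w : S' w -> w <> t -> exists2 v, S v & same_side t w v.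
    move=> [Sw|aw] wt; first by exists w => //; exact: same_sidexx.
    exists t0 => //; have := free_S aw.1 St; rewrite /same_side.
    by have := dist_pos tt0; pt2 t t0; pt2 t w; lra.
  move=> w1 w2 w3 S1 S2 S3 n1 n2 n3.
  have [v1 V1 s1] := toS _ S1 n1; have [v2 V2 s2] := toS _ S2 n2.
  have [v3 V3 s3] := toS _ S3 n3.
  have := few' _ _ _ V1 V2 V3 (same_side_neq s1).2 (same_side_neq s2).2
    (same_side_neq s3).2.
  by case=> hs; [constructor 1|constructor 2|constructor 3];
    apply: same_side_trans (same_side_trans hs (same_sideC _)).
have [//|at_] := S't; right.
(* From a point of an arc the only directions are towards [t0] and towards the tip. *)
have two w : S' w -> w <> t -> same_side t w t0 \/ same_side t w (tip t).
  move=> S'w wt; have [tw|/not_same_side tw] := pselect (same_side t0 t w); last first.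
    by left; rewrite /same_side; have := dist_pos tt0; pt2 t t0; pt2 t w; pt2 w t0; lra.
  have aw := arc_side S'w at_.1 tw; have ew := aw.2; rewrite -(tip_side tw) in ew.
  have := segment_dist at_.2 ew; have := at_.2; have := dist_pos wt; pt2 w t.
  rewrite /same_side; pt2 w t0; pt2 t t0.
  by case: (lerP (d t0 w) (d t0 t)) => ? *; [left|right]; lra.
move=> w1 w2 w3 S1 S2 S3 n1 n2 n3.
have link x y z : same_side t x z -> same_side t y z -> same_side t x y.
  by move=> xz yz; exact: same_side_trans (same_sideC yz).
case: (two _ S1 n1) => s1; case: (two _ S2 n2) => s2; case: (two _ S3 n3) => s3;
  by [constructor 1; exact: link s1 s2|constructor 2; exact: link s1 s3
     |constructor 3; exact: link s2 s3].
Qed.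

Lemma attach_arcs : exists Q,
  [/\ partial_map Q, extends (S, f) Q & saturated Q.1 Q.2 t0].
Proof.
exists (S', f'); split; [|exact: attach_extends|exact: attach_saturated].
split; [exact: attach_gate|exact: attach_cont|exact: attach_light|].
exact: attach_sides.
Qed.

End Saturate.

(** * Targets for the branches and the maximal partial map *)

Hypothesis X_nontrivial : more_than_one_point X.

(* Three branches for each target, since two of them may already be in use. *)
Lemma side_targets x t : exists lab : T -> X,
  [/\ forall z, lab z <> x, forall z w, same_side t z w -> lab z = lab w
    & forall y, y <> x -> exists z1 z2 z3,
        [/\ z1 <> t, z2 <> t & z3 <> t] /\
        [/\ lab z1 = y, lab z2 = y & lab z3 = y] /\
        [/\ ~ same_side t z1 z2, ~ same_side t z1 z3 & ~ same_side t z2 z3]].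
Proof.
have [y0 y0x] : exists y, y <> x.
  have [y [y' yy']] := X_nontrivial; have [yx|] := pselect (y = x); last by exists y.
  by exists y' => y'x; apply: yy'; rewrite yx y'x.
have [rho [rho_side rho_surj]] := side_labels (valencyT t).
(* The intervals [0, 1], [2, 3] and [4, 5] each run through [g], so the labels [a], [a + 2] and
   [a + 4] give three sides with target [y]. A move needs distinct ends, so the target [x] is
   replaced by [y0]. *)
pose code v := if v <= 1 then g v else if v <= 3 then g (v - 2) else g (v - 4).
exists (fun z => if `[< code (rho z) = x >] then y0 else code (rho z)).
split=> [z|z w /rho_side ->//|y yx]; first by case: asboolP.
have [a /andP[a0 a1]] := gsurj y.
have [gt2 le2 gt4] : [/\ 1 < a + 2, a + 2 <= 3 & 3 < a + 4] by split; lra.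
have gt4' : 1 < a + 4 by lra.
move=> ga.
have pick k : code (a + k) = y -> exists z,
    [/\ z <> t, rho z = a + k &
        (if `[< code (rho z) = x >] then y0 else code (rho z)) = y].
  move=> cy; have [z zt rz] := rho_surj (a + k); exists z; split=> //.
  by rewrite rz cy; case: asboolP.
have [|z1 [z1t r1 l1]] := pick 0.
  by rewrite /code addr0 a1.
have [|z2 [z2t r2 l2]] := pick 2.
  by rewrite /code addrK le2 leNgt gt2.
have [|z3 [z3t r3 l3]] := pick 4.
  by rewrite /code addrK !leNgt gt4 gt4'.
by exists z1, z2, z3; do !split=> //; move=> /rho_side; rewrite ?r1 ?r2 ?r3 => /addrI; lra.
Qed.

Lemma saturate P t : partial_map P -> P.1 t -> few_sides P.1 t ->
  exists Q, [/\ partial_map Q, extends P Q & saturated Q.1 Q.2 t].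
Proof.
case: P => S f pmP St few.
have [h [c [slow short]]] := slow_path_family dX_eq0 dX_sym dX_tri gcont gsurj (f t).
have [lab [lab_neq lab_side lab_surj]] := side_targets (f t) t.
exact: (@attach_arcs S f t pmP St few h c slow short lab).
Qed.

Lemma saturated_map : more_than_one_point T -> exists2 f : T -> X,
  partial_map (setT, f) & forall t, saturated setT f t.
Proof.
move=> [t0 _].
have [||A Apm A0 Atot|[S f] pmP Pmax] :=
  @premaximal_on _ partial_map extends ([set t0], fun=> g 0) _ extends_refl.
- split=> /= [t|t e _ e0|a b -> ->//|t ->].
  + by exists t0; split=> // z ->; rewrite mdistxx addr0.
  + by exists 1 => // w _ _; rewrite (dist_xx dX_eq0).
  + by right=> w1 w2 w3 -> _ _ /(_ erefl).
- by move=> P Q W pQ; exact: extends_trans.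
- exact: chain_bound.
have sat t : S t -> saturated S f t.
  move=> St; have [//|few] := pm_sides pmP St.
  have [Q [pQ PQ satQ]] := saturate pmP St few.
  have [PQs _ _] := PQ.
  (* By maximality [(S, f)] extends [Q] in turn, so saturation passes back to it. *)
  exact: (saturated_extends (Pmax _ pQ PQ) (PQs _ St) satQ).
(* A point outside [S] would lie, seen from its gate, on a side that misses [S], contrary to
   saturation at the gate. *)
have ST : S = setT.
  apply/seteqP; split=> // t _; have [s [Ss gs]] := pm_gate pmP t.
  have [->//|ts] := pselect (t = s).
  have [/(_ _ ts)[w Sw tw] _ _] := sat _ Ss.
  by have /not_same_side/(_ tw) := gs _ Sw.
by rewrite ST in pmP sat; exists f => // t; exact: sat.
Qed.

End Tree.

Definition clamp {R : realType} (u : R) :=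
  if u <= 0 then 0 else if u <= 1 then u else 1.

Lemma clamp01 {R : realType} (u : R) : 0 <= clamp u <= 1.
Proof.
rewrite /clamp; case: (leP u 0) => [_|/ltW u0]; first by rewrite lexx ler01.
by case: (leP u 1) => u1; rewrite ?u0 ?u1 ?ler01 ?lexx.
Qed.

Lemma clamp_lipschitz {R : realType} (u v : R) : `|clamp u - clamp v| <= `|u - v|.
Proof.
have := ler_norm (u - v); have := ler_norm (v - u); rewrite distrC ler_norml /clamp.
by case: (leP u 0) => ?; case: (leP u 1) => ?; case: (leP v 0) => ?;
  case: (leP v 1) => ? ? ?; apply/andP; split; lra.
Qed.

Theorem corollary4 (R : realType) (A_c : metricType R) (hA : is_A_c A_c)
    (X : topologicalType) (hX : Peano_continuum R X)
    (hX1 : more_than_one_point X) :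
  exists f : A_c -> X,
    [/\ continuous f, light f, open_mapping f & range f = [set: X]].
Proof.
have [[geoA ntA hypA] complA valA] := hA.
have [[d [d_eq0 d_sym d_tri d_nbhs]] [g gcont grange]] := hX.
have nbhsA (t : A_c) (U : set A_c) :
    nbhs t U <-> exists2 e : R, 0 < e & forall w, mdist t w < e -> U w.
  rewrite -nbhs_ballE; split=> [[e e0 eU]|[e e0 eU]]; exists e => // w.
    by move=> tw; apply: eU; rewrite ballEmdist.
  by rewrite ballEmdist; exact: eU.
(* Clamping makes the path continuous on the whole line, as [continuous_path] asks. *)
pose g' u := g (clamp u).
have g'cont : continuous_path d g'.
  move=> u e e0; have u01 := clamp01 u.
  move/subspace_continuousP/(_ (clamp u)): gcont; rewrite /= in_itv /= => /(_ u01) gu.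
  have : nbhs (g' u) [set y | d (g' u) y < e] by apply/d_nbhs; exists e.
  move=> /gu /nbhs_ballP[r /= r0 rP]; exists r => // v uv.
  apply: rP; first exact: le_lt_trans (clamp_lipschitz u v) uv.
  by rewrite /= in_itv; exact: clamp01.
have g'surj x : exists2 a, 0 <= a <= 1 & g' a = x.
  have [a] : (g @` `[0, 1]) x by rewrite grange.
  rewrite /= in_itv /= => /andP[a0 a1] <-; exists a; first by rewrite a0.
  rewrite /g' /clamp a1; case: (leP a 0) => // a0'.
  by congr g; apply/eqP; rewrite eq_le a0.
have [f pmf satf] :=
  saturated_map geoA hypA complA valA d_eq0 d_sym d_tri g'cont g'surj hX1 ntA.
exists f; split.
- move=> t U /d_nbhs[e e0 eU]; apply/nbhsA.
  have [r r0 rP] := pm_cont pmf (I : setT t) e0.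
  by exists r => // w tw; apply: eU; exact: rP.
- move=> x t ft; apply/seteqP; split=> [w [C [Ct Cf Cconn] Cw]|_ ->]; last first.
    exact: connected_component_refl.
  apply: contrapT => /= wt.
  (* A point of the segment missing from [C] would separate [w] from [t]. So [C] contains the
     segment, on which [f] is not constant. *)
  have seg u : mdist w u + mdist u t = mdist w t -> C u.
    move=> wut; apply: contrapT => nCu.
    have := connected_same_side hypA Cconn nCu Cw Ct.
    by apply/not_same_side; rewrite wut.
  have [u [v [_ /seg Cu /seg Cv /= fuv]]] := pm_light pmf (I : setT w) (I : setT t) wt.
  by apply: fuv; rewrite (Cf _ Cu) (Cf _ Cv).
- move=> U; rewrite !openE => oU _ [t Ut <-].
  have /nbhsA[e e0 eU] := oU _ Ut; have [_ /(_ e e0)[r r0 rP] _] := satf t.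
  by apply/d_nbhs; exists r => // y /rP[w [_ /eU Uw <-]]; exists w.
- apply/seteqP; split=> // x _; have [t0 _] := ntA.
  by have [_ _ /(_ x)[t _ <-]] := satf t0; exists t.
Qed.
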